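(* Let $\phi$ be a posterior family for a model $\pi$ with data space $Y$ and parameter space $\Theta$, and let $g(\theta,y)=\frac{\pi_{\text{post}}(\theta\mid y)}{\phi(\theta\mid y)}$. Then $\phi$ passes continuous SBC with respect to $g$ if and only if $$\int_Y\int_\Theta \pi_{\text{joint}}(y,\theta)\,\mathbb{I}\big[\pi_{\text{post}}(\theta\mid y)\neq\phi(\theta\mid y)\big]\,\mathrm{d}\theta\,\mathrm{d}y=0.$$
   Context: Model $\pi$: prior density $\pi_{\text{prior}}(\theta)$ on $\Theta$, observation density $\pi_{\text{obs}}(y\mid\theta)$ on $Y$, $\pi_{\text{joint}}(y,\theta)=\pi_{\text{obs}}(y\mid\theta)\pi_{\text{prior}}(\theta)$, $\pi_{\text{marg}}(y)=\int_\Theta\pi_{\text{joint}}(y,\theta)\,\mathrm{d}\theta$, $\pi_{\text{post}}(\theta\mid y)=\pi_{\text{joint}}(y,\theta)/\pi_{\text{marg}}(y)$. A posterior family is $\phi:\Theta\times Y\to\mathbb{R}^+$ with $\int_\Theta\phi(\theta\mid y)\,\mathrm{d}\theta=1$ for all $y$; a test quantity is a measurable real function on $\Theta\times Y$. For a test quantity $f$: $C_{\phi,f}(s\mid y)=\int_\Theta\mathbb{I}[f(\theta,y)\le s]\phi(\theta\mid y)\,\mathrm{d}\theta$, $D_{\phi,f}(s\mid y)=\int_\Theta\mathbb{I}[f(\theta,y)=s]\phi(\theta\mid y)\,\mathrm{d}\theta$; with $U\sim\mathrm{uniform}[0,1]$, $r_{\phi,f}(x\mid\tilde\theta,y)=\Pr\big(C_{\phi,f}(f(\tilde\theta,y)\mid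 y)-U\,D_{\phi,f}(f(\tilde\theta,y)\mid y)\le x\big)$, $q_{\phi,f}(x\mid y)=\int_\Theta\pi_{\text{post}}(\tilde\theta\mid y)r_{\phi,f}(x\mid\tilde\theta,y)\,\mathrm{d}\tilde\theta$. $\phi$ passes continuous SBC w.r.t. $f$ if $\int_Yq_{\phi,f}(x\mid y)\pi_{\text{marg}}(y)\,\mathrm{d}y=x$ for all $x\in[0,1]$. *)

(* Defs.v *)
From HB Require Import structures.
From mathcomp Require Import all_boot all_order all_algebra.
From mathcomp Require Import all_classical all_reals all_analysis.
Set Implicit Arguments. Unset Strict Implicit. Unset Printing Implicit Defensive.
Import Order.TTheory GRing.Theory Num.Theory.
Local Open Scope classical_set_scope.
Local Open Scope ring_scope.

(* Conventions: parameter space Theta with reference measure muT ("d theta"),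
   data space Y with reference measure muY ("d y").
   prior : Theta -> R,  obs : Theta -> Y -> R  (obs t y = pi_obs(y | t)),
   phi : Theta -> Y -> R  (phi t y = phi(t | y)),
   test quantities f : Theta -> Y -> R  (f t y = f(t, y)). *)

Section SBC.
Context {R : realType} {d1 d2 : measure_display}
  {Theta : measurableType d1} {Y : measurableType d2}.
Variables (muT : {measure set Theta -> \bar R}) (muY : {measure set Y -> \bar R}).

Definition pi_joint (prior : Theta -> R) (obs : Theta -> Y -> R) (y : Y) (t : Theta) : R :=
  obs t y * prior t.

Definition pi_marg prior obs (y : Y) : \bar R :=
  (\int[muT]_t (pi_joint prior obs y t)%:E)%E.

Definition pi_post prior obs (t : Theta) (y : Y) : R :=
  pi_joint prior obs y t / fine (pi_marg prior obs y).

Definition C_SBC (phi f : Theta -> Y -> R) (s : R) (y : Y) : \bar R :=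
  (\int[muT]_t (((f t y <= s)%R)%:R * phi t y)%:E)%E.

Definition D_SBC (phi f : Theta -> Y -> R) (s : R) (y : Y) : \bar R :=
  (\int[muT]_t (((f t y == s)%R)%:R * phi t y)%:E)%E.

(* r_{phi,f}(x | t0, y) = Pr_{U ~ uniform[0,1]}(C(f(t0,y)|y) - U D(f(t0,y)|y) <= x) *)
Definition r_SBC (phi f : Theta -> Y -> R) (x : R) (t0 : Theta) (y : Y) : \bar R :=
  (@lebesgue_measure R)
    (`[0, 1]%classic `&`
     [set u : R | (C_SBC phi f (f t0 y) y - u%:E * D_SBC phi f (f t0 y) y <= x%:E)%E]).

Definition q_SBC prior obs (phi f : Theta -> Y -> R) (x : R) (y : Y) : \bar R :=
  (\int[muT]_t ((pi_post prior obs t y)%:E * r_SBC phi f x t y))%E.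

Definition passes_SBC prior obs (phi f : Theta -> Y -> R) : Prop :=
  forall x : R, 0 <= x <= 1 ->
    (\int[muY]_y (q_SBC prior obs phi f x y * pi_marg prior obs y))%E = x%:E.

End SBC.

(* Main.v *)
(* Fix an observation [y] and let [q] be the rank distribution function at level
   [x] in ]0, 1[. Under [phi] the randomized rank [C - U * D] is uniform, and the
   probability [r] that it is at most [x] is a non-increasing function of [g]: it is
   [1] below the [x]-quantile [c] of [g], [0] above it. Hence
   [(c - g) * (r - x) * phi] is nonnegative; as [phi] and [g * phi] both have mass
   [1], its integral is [x - q]. So [q <= x] for every [y], and equality forces
   [g = c] almost everywhere, whence [c = 1] and the posterior equals [phi]. If SBC
   passes, the nonnegative gaps [x - q] average to zero over [y], so a single
   level, say [x = 1/2], is enough. Conversely [g = 1] makes the rank uniform. *)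
Require Import Defs.
From HB Require Import structures.
From mathcomp Require Import all_boot all_order all_algebra.
From mathcomp Require Import all_classical all_reals all_analysis.
From mathcomp Require Import measurable_realfun lra ring.
Import Order.TTheory GRing.Theory Num.Theory.
Local Open Scope classical_set_scope.
Local Open Scope ring_scope.

(** * Quantiles of a nonnegative function under a probability density *)

Section quantile.
Set Implicit Arguments. Unset Strict Implicit.
Context {R : realType} {d : measure_display} {T : measurableType d}.
Variables (mu : {measure set T -> \bar R}) (w g : T -> R).
Hypotheses (mw : measurable_fun setT w) (w0 : forall t, 0 <= w t).

(** Continuity from below of the measure with density [w]. It carries the bounds known at levels [s]
    away from the quantile over to the quantile itself. *)
Lemma integral_bigcup_le (F : nat -> set T) (k : \bar R) :
  (forall n, measurable (F n)) -> nondecreasing_seq F ->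
  (forall n, (\int[mu]_(t in F n) (w t)%:E <= k)%E) ->
  (\int[mu]_(t in \bigcup_n F n) (w t)%:E <= k)%E.
Proof.
move=> mF ndF leFk.
have cvgF : (\int[mu]_(t in F i) (w t)%:E)%E @[i --> \oo] -->
    (\int[mu]_(t in \bigcup_i F i) (w t)%:E)%E.
  apply: ge0_nondecreasing_set_cvg_integral => //.
    by move=> n; exact/measurable_EFinP/measurable_funTS.
  by move=> n t _; rewrite lee_fin.
rewrite -(cvg_lim _ cvgF)//; apply: lime_le; first exact: cvgP cvgF.
exact: nearW.
Qed.

Hypotheses (mg : measurable_fun setT g) (g0 : forall t, 0 <= g t).
Hypothesis w1 : (\int[mu]_t (w t)%:E = 1)%E.

Let mass A : \bar R := (\int[mu]_(t in A) (w t)%:E)%E.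

Let mle s : measurable [set t | g t <= s].
Proof.
by rewrite -[X in measurable X]setTI; apply: measurable_fun_ler.
Qed.

Let mlt s : measurable [set t | g t < s].
Proof.
by rewrite -[X in measurable X]setTI; apply: measurable_fun_ltr.
Qed.

Let mgt s : measurable [set t | s < g t].
Proof.
by rewrite -[X in measurable X]setTI; apply: measurable_fun_ltr.
Qed.

Lemma le_integral_set (A B : set T) : measurable A -> measurable B -> A `<=` B ->
  (\int[mu]_(t in A) (w t)%:E <= \int[mu]_(t in B) (w t)%:E)%E.
Proof.
move=> mA mB AB; apply: ge0_subset_integral => //.
  by exact/measurable_EFinP/measurable_funTS.
by move=> t _; rewrite lee_fin.
Qed.

(** The witness is the infimum of the levels [s] at which the mass of [g <= s] exceeds [x] strictly.
    This strictness gives the strict bound above [c], which later forces the rank probability to be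
    exactly [0] there. The set of levels is nonempty because [x < 1] is less than the total mass,
    and bounded below by [0] because [g] is nonnegative. *)
Lemma quantile_exists (x : R) : 0 <= x -> x < 1 -> exists c : R,
  [/\ 0 <= c,
      (\int[mu]_(t in [set t | (g t < c)%R]) (w t)%:E <= x%:E)%E,
      (x%:E <= \int[mu]_(t in [set t | (g t <= c)%R]) (w t)%:E)%E,
      (forall s, s < c -> (\int[mu]_(t in [set t | (g t <= s)%R]) (w t)%:E <= x%:E)%E) &
      (forall s, c < s -> (x%:E < \int[mu]_(t in [set t | (g t < s)%R]) (w t)%:E)%E)].
Proof.
move=> x0 x1.
pose S := [set s : R | (x%:E < mass [set t | (g t <= s)%R])%E].
have S0 : S !=set0.
  apply: contrapT => nS.
  suff : (mass setT <= x%:E)%E by rewrite /mass w1 lee_fin leNgt x1.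
  have -> : setT = \bigcup_n [set t | g t <= n%:R].
    apply/seteqP; split => // t _; exists (Num.truncn (g t)).+1 => //=.
    by rewrite ltW// truncnS_gt.
  apply: integral_bigcup_le => //.
    move=> m n mn; rewrite subsetEset => t /= /le_trans; apply.
    by rewrite ler_nat.
  by move=> n; rewrite leNgt; apply/negP => lt; apply: nS; exists n%:R.
have lbS : lbound S 0.
  move=> s; apply: contraPP => /negP; rewrite -ltNge => s0.
  rewrite /S/= /mass (_ : [set t | _] = set0) ?integral_set0.
    by apply/negP; rewrite -leNgt lee_fin.
  apply/seteqP; split => // t /= gs.
  by have := le_lt_trans gs s0; rewrite ltNge g0.
have hS : has_inf S by split => //; exists 0.
have below s : s < inf S -> (mass [set t | (g t <= s)%R] <= x%:E)%E.
  move=> sc; rewrite leNgt; apply/negP => sS.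
  by have := ge_inf hS.2 sS; rewrite leNgt sc.
have above s : inf S < s -> (x%:E < mass [set t | (g t < s)%R])%E.
  move=> cs; have [u Su us] := inf_lt S0 cs.
  apply: (lt_le_trans Su); apply: le_integral_set => // t /= gu.
  exact: le_lt_trans us.
exists (inf S); split => //.
- exact: lb_le_inf.
(* The strict sublevel set is exhausted by the sets [g <= c - 1/(n+1)], each of mass at most [x]. A
   point with [g t < c] belongs to the one whose index is the integer part of [1 / (c - g t)]. *)
- have -> : [set t | g t < inf S] = \bigcup_n [set t | g t <= inf S - n.+1%:R^-1].
    apply/seteqP; split => [t /= gc|t [n _ /= gn]].
      have dc : 0 < inf S - g t by rewrite subr_gt0.
      exists (Num.truncn (inf S - g t)^-1) => //=.
      rewrite lerBrDr -lerBrDl -[leRHS]invrK lef_pV2 ?posrE ?invr_gt0//.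
      by rewrite ltW// truncnS_gt.
    by rewrite (le_lt_trans gn)// ltrBlDr ltrDl invr_gt0.
  apply: integral_bigcup_le => //.
    move=> m n mn; rewrite subsetEset => t /= /le_trans; apply.
    by rewrite lerB// lef_pV2 ?posrE// ler_nat.
  by move=> n; apply: below; rewrite ltrBlDr ltrDl invr_gt0.
- have split_mass s : (mass [set t | (g t <= s)%R] + mass [set t | (s < g t)%R] = 1)%E.
    rewrite -w1 -ge0_integral_setU//.
    + congr (integral _ _ _); apply/seteqP; split => // t _ /=.
      by case: (leP (g t) s); [left|right].
    + by exact/measurable_EFinP/measurable_funTS.
    + by move=> t _; rewrite lee_fin.
    + apply/disj_setPS => t [/= gs]; rewrite ltNge.
      by rewrite gs.
  have mass_fin A : measurable A -> mass A \is a fin_num.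
    move=> mA; rewrite ge0_fin_numE.
      apply: (@le_lt_trans _ _ 1%E); last exact: ltry.
      by rewrite -w1; apply: le_integral_set.
    by apply: integral_ge0 => t _; rewrite lee_fin.
  (* The set [g <= c] is a decreasing limit, so its complement is treated instead. The complement is
     the increasing union of the sets [c + 1/(n+1) < g], and continuity from below applies once
     more. *)
  suff : (mass [set t | (inf S < g t)%R] <= 1 - x%:E)%E.
    have := split_mass (inf S).
    rewrite -[X in (X + _)%E]fineK ?mass_fin// -[X in (_ + X)%E]fineK ?mass_fin//.
    rewrite -/(mass _) -[X in (X <= _)%E]fineK ?mass_fin//.
    rewrite -[X in _ -> (_ <= X)%E]fineK ?mass_fin//.
    by rewrite -EFinD -EFinB !lee_fin => -[]; lra.
  have -> : [set t | inf S < g t] = \bigcup_n [set t | inf S + n.+1%:R^-1 < g t].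
    apply/seteqP; split => [t /= gc|t [n _ /= gn]].
      have dc : 0 < g t - inf S by rewrite subr_gt0.
      exists (Num.truncn (g t - inf S)^-1) => //=.
      rewrite -ltrBrDl -[ltRHS]invrK ltf_pV2 ?posrE ?invr_gt0//.
      by rewrite truncnS_gt.
    by rewrite (le_lt_trans _ gn)// lerDl invr_ge0.
  apply: integral_bigcup_le => //.
    move=> m n mn; rewrite subsetEset => t /=; apply: le_lt_trans.
    by rewrite lerD2l lef_pV2 ?posrE// ler_nat.
  move=> n; set s := inf S + _.
  have cs : inf S < s by rewrite ltrDl invr_gt0.
  have := split_mass s; have := above _ cs.
  move=> /lt_le_trans /(_ (le_integral_set (mlt s) (mle s) (fun t => @ltW _ _ _ _))).
  rewrite -/(mass _) -[X in (_ < X)%E]fineK ?mass_fin//.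
  rewrite -[X in _ -> (X + _)%E = _ -> _]fineK ?mass_fin//.
  rewrite -[X in _ -> (_ + X)%E = _ -> _]fineK ?mass_fin//.
  rewrite -[X in _ -> _ -> (X <= _)%E]fineK ?mass_fin//.
  by rewrite -EFinD -EFinB lte_fin lee_fin => + []; lra.
Qed.

End quantile.

(** * The law of [a - U * d] for [U] uniform on the unit interval *)

Section randomization.
Set Implicit Arguments. Unset Strict Implicit.
Context {R : realType}.
Implicit Types a d x : R.

Let unif_le1 : (@lebesgue_measure R) `[0, 1]%classic = 1%E.
Proof. by rewrite lebesgue_measure_itv/= lte_fin ltr01 oppr0 adde0. Qed.

Lemma uniform_le_eq1 a d x : 0 <= d -> a <= x ->
  (@lebesgue_measure R)
    (`[0, 1]%classic `&` [set u : R | (a%:E - u%:E * d%:E <= x%:E)%E]) = 1%E.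
Proof.
move=> d0 ax; rewrite -[RHS]unif_le1; congr (_ _); apply/setIidPl => u /=.
rewrite in_itv/= => /andP[u0 _]; rewrite lee_fin.
by rewrite lerBlDr (le_trans ax)// lerDl mulr_ge0.
Qed.

(** On the unit interval [a - u * d] is smallest at [u = 1], where it still exceeds [x]. *)
Lemma uniform_le_eq0 a d x : 0 <= d -> x < a - d ->
  (@lebesgue_measure R)
    (`[0, 1]%classic `&` [set u : R | (a%:E - u%:E * d%:E <= x%:E)%E]) = 0%E.
Proof.
move=> d0 ax; rewrite -[RHS](measure0 (@lebesgue_measure R)); congr (_ _).
apply/seteqP; split => // u /= []; rewrite in_itv/= => /andP[u0 u1].
rewrite lee_fin leNgt => /negP; apply.
by rewrite (lt_le_trans ax)// lerD2l lerN2 ler_piMl.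
Qed.

(* [rho * d = x - a + d] is stated without division so that it also covers an
   atomless value, [d = 0]. *)
Lemma uniform_le_mid a d x : 0 <= d -> a - d <= x -> x <= a -> exists rho : R,
  [/\ (@lebesgue_measure R)
    (`[0, 1]%classic `&` [set u : R | (a%:E - u%:E * d%:E <= x%:E)%E]) = rho%:E,
    0 <= rho, rho <= 1 & rho * d = x - a + d].
Proof.
move=> d0 adx xa; have [d00|dn0] := eqVneq d 0.
  have {adx xa} ax : a = x by apply/le_anti; rewrite xa andbT -[a]subr0 -d00.
  exists 1; rewrite uniform_le_eq1 ?ax ?d00//; split => //.
  by rewrite subrr addr0 mulr0.
have dp : 0 < d by rewrite lt_neqAle eq_sym dn0.
(* For [d > 0] the condition [a - u * d <= x] reads [b <= u], so the event is the interval from [b]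
   to [1]. *)
pose b := (a - x) / d.
have b0 : 0 <= b by rewrite divr_ge0// subr_ge0.
have b1 : b <= 1 by rewrite ler_pdivrMr// mul1r; lra.
exists (1 - b); split; [|by rewrite subr_ge0|by rewrite lerBlDr lerDl|].
  transitivity ((@lebesgue_measure R) `[b, 1]%classic); last first.
    rewrite lebesgue_measure_itv/= lte_fin.
    case: ltP => // b1'; rewrite (_ : b = 1) ?subrr//.
    by apply/le_anti; rewrite b1.
  congr (_ _); apply/seteqP; split => u /=; rewrite !in_itv/= lee_fin.
    move=> [/andP[_ ->]]; rewrite andbT ler_pdivrMr//; lra.
  move=> /andP[bu ->]; rewrite (le_trans b0 bu); split => //.
  move: bu; rewrite ler_pdivrMr//; lra.
by rewrite mulrBl mul1r /b divfK//; lra.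
Qed.

End randomization.

Lemma measurable_fun_bool_natr {R : realType} {d : measure_display}
  {T : measurableType d} (b : T -> bool) :
  measurable_fun setT b -> measurable_fun setT (fun t => (b t)%:R : R).
Proof.
move=> mb; rewrite (_ : (fun t => _) = fun t => if b t then 1 else 0); last first.
  by apply/funext => t; case: (b t).
exact: measurable_fun_ifT.
Qed.

(** * The rank distribution at a fixed observation *)

Section one_observation.
Set Implicit Arguments. Unset Strict Implicit.
Context {R : realType} {d1 d2 : measure_display}
  {Theta : measurableType d1} {Y : measurableType d2}.
Variables (muT : {measure set Theta -> \bar R}) (phi g : Theta -> Y -> R) (y : Y).
Hypotheses (mphi : measurable_fun setT (phi ^~ y)) (phi0 : forall t, 0 < phi t y).
Hypotheses (mg : measurable_fun setT (g ^~ y)).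
Hypothesis phi1 : (\int[muT]_t (phi t y)%:E = 1)%E.

Let mass A : \bar R := (\int[muT]_(t in A) (phi t y)%:E)%E.

Lemma C_SBC_set s : C_SBC muT phi g s y =
  (\int[muT]_(t in [set t | (g t y <= s)%R]) (phi t y)%:E)%E.
Proof.
rewrite [RHS]integral_mkcond; apply: eq_integral => t _.
rewrite patchE; have [gs|gs] := boolP (g t y <= s).
  by rewrite mem_set// mul1r.
by rewrite memNset ?mul0r//=; exact/negP.
Qed.

Lemma D_SBC_set s : D_SBC muT phi g s y =
  (\int[muT]_(t in [set t | g t y = s]) (phi t y)%:E)%E.
Proof.
rewrite [RHS]integral_mkcond; apply: eq_integral => t _.
rewrite patchE; have [gs|/eqP gs] := eqVneq (g t y) s.
  by rewrite mem_set// mul1r.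
by rewrite memNset ?mul0r.
Qed.

Hypothesis g0 : forall t, 0 <= g t y.

Let meq s : measurable [set t | g t y = s].
Proof.
rewrite (_ : [set t | _] = (g ^~ y) @^-1` [set s])//.
by rewrite -[X in measurable X]setTI; apply: mg.
Qed.

Let mlt s : measurable [set t | g t y < s].
Proof. by rewrite -[X in measurable X]setTI; apply: measurable_fun_ltr. Qed.

Let mle s : measurable [set t | g t y <= s].
Proof. by rewrite -[X in measurable X]setTI; apply: measurable_fun_ler. Qed.

Let phi_ge0 t : 0 <= phi t y. Proof. exact: ltW. Qed.

Let mass_ge0 A : (0 <= mass A)%E.
Proof. by apply: integral_ge0 => t _; rewrite lee_fin. Qed.

Let mass_fin A : measurable A -> mass A \is a fin_num.
Proof.
move=> mA; rewrite ge0_fin_numE; last exact: mass_ge0.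
apply: (@le_lt_trans _ _ 1%E); last exact: ltry.
by rewrite -phi1; exact: (le_integral_set muT mphi phi_ge0 mA measurableT).
Qed.

(** Both values are finite because [phi] has total mass [1]. The last conjunct identifies [C - D],
    the lower end of the values of the randomized rank, with the mass of the strict sublevel set. *)
Lemma C_D_SBC_fin s : exists a d : R,
  [/\ C_SBC muT phi g s y = a%:E, D_SBC muT phi g s y = d%:E, 0 <= d &
      (\int[muT]_(t in [set t | (g t y < s)%R]) (phi t y)%:E = (a - d)%:E)%E].
Proof.
exists (fine (mass [set t | g t y <= s])), (fine (mass [set t | g t y = s])).
have D : (mass [set t | (g t y <= s)%R] =
    mass [set t | (g t y < s)%R] + mass [set t | g t y = s])%E.
  rewrite -ge0_integral_setU//.
  - congr (integral _ _ _); apply/seteqP; split => t /=.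
      by rewrite le_eqVlt => /orP[/eqP|]; [right|left].
    by move=> [/ltW|->].
  - exact/measurable_EFinP/measurable_funTS.
  - by move=> t _; rewrite lee_fin.
  - by apply/disj_setPS => t [/= + gs]; rewrite gs ltxx.
split.
- by rewrite fineK ?mass_fin// C_SBC_set.
- by rewrite fineK ?mass_fin// D_SBC_set.
- by rewrite fine_ge0.
- by rewrite EFinB !fineK ?mass_fin// D addeK// mass_fin.
Qed.

(** With [c] the [x]-quantile of [g] under [phi], the event of rank at most [x] becomes a randomized
    threshold test on [g]: accept below [c], reject above it, accept with probability [rho] on the
    level [c]. The final equation is the uniformity of the rank under [phi]. *)
Lemma r_SBC_step x : 0 <= x -> x < 1 -> exists c rho : R,
  [/\ 0 <= c, 0 <= rho <= 1,
      forall t, r_SBC muT phi g x t y =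
        ((g t y < c)%R%:R + rho * (g t y == c)%:R)%:E &
      (\int[muT]_t (((g t y < c)%R%:R + rho * (g t y == c)%:R) * phi t y)%:E =
        x%:E)%E].
Proof.
move=> x0 x1.
have [c [c0 ltcx xlec below above]] :=
  quantile_exists mphi phi_ge0 mg g0 phi1 x0 x1.
have [a [dc [Ca Dd d0 ltc]]] := C_D_SBC_fin c.
move: ltcx xlec; rewrite -C_SBC_set Ca ltc !lee_fin => adx xa.
have [rho [rhoE rho0 rho1 rhod]] := uniform_le_mid d0 adx xa.
exists c, rho; split => //; first by rewrite rho0.
- move=> t; rewrite /r_SBC.
  (* Below [c] the value of [C] is already at most [x], so every [u] qualifies. Above [c] even the
     smallest rank [C - D] exceeds [x]. At [c] the probability is [rho] by its choice. *)
  have [gc|cg|->] := ltgtP (g t y) c.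
  + have [a' [d' [Ca' -> d'0 _]]] := C_D_SBC_fin (g t y).
    rewrite Ca' uniform_le_eq1//; first by rewrite mulr0 addr0.
    by rewrite -lee_fin -Ca' C_SBC_set; exact: below.
  + have [a' [d' [-> -> d'0 ltg]]] := C_D_SBC_fin (g t y).
    rewrite uniform_le_eq0//; first by rewrite mulr0 addr0.
    by rewrite -lte_fin -ltg; exact: above.
  + by rewrite Ca Dd rhoE mulr1 add0r.
(* The strict part has mass [a - dc] and the level [c] contributes [rho * dc]; by the choice of
   [rho] the sum is [x]. *)
- have mu1 := measurable_fun_bool_natr (measurable_fun_ltr mg (measurable_cst c)).
  have mu2 := measurable_fun_bool_natr (measurable_fun_eqr mg (measurable_cst c)).
  under eq_integral do rewrite mulrDl -mulrA EFinD [X in (_ + X)%E]EFinM.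
  rewrite ge0_integralD//=; last 4 first.
  + by move=> t _; rewrite lee_fin mulr_ge0.
  + by apply/measurable_EFinP/measurable_funM.
  + by move=> t _; rewrite lee_fin !mulr_ge0.
  + apply/measurable_EFinP/measurable_funM => //.
    exact: measurable_funM.
  rewrite ge0_integralZl//=; last 2 first.
  + by apply/measurable_EFinP/measurable_funM.
  + by move=> t _; rewrite lee_fin mulr_ge0.
  rewrite -/(D_SBC muT phi g c y) Dd -EFinM rhod.
  rewrite (_ : integral _ _ _ = (a - dc)%:E) -?EFinD; first by congr _%:E; lra.
  rewrite -ltc [RHS]integral_mkcond; apply: eq_integral => t _.
  rewrite patchE; have [gs|gs] := boolP (g t y < c).
    by rewrite mem_set// mul1r.
  by rewrite memNset ?mul0r//=; exact/negP.
Qed.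

Hypothesis gphi1 : (\int[muT]_t (g t y * phi t y)%:E = 1)%E.

(** This is a Neyman-Pearson argument: among tests of size [x] under [phi], thresholding the density
    ratio [g] is extremal under the density [g * phi], which stands for the posterior. *)
Lemma q_SBC_gap x : 0 < x -> x < 1 ->
  let q := (\int[muT]_t ((g t y * phi t y)%:E * r_SBC muT phi g x t y))%E in
  (q <= x%:E)%E /\ (q = x%:E -> {ae muT, forall t, g t y = 1}).
Proof.
move=> x0 x1 q.
have mgphi : measurable_fun setT (fun t => g t y * phi t y) by exact: measurable_funM.
have [c [rho [c0 /andP[rho0 rho1] rE int_r]]] := r_SBC_step (ltW x0) x1.
pose r t := (g t y < c)%R%:R + rho * (g t y == c)%:R.
have r0 t : 0 <= r t by rewrite addr_ge0// mulr_ge0.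
pose h t := (c - g t y) * (r t - x) * phi t y.
have mr : measurable_fun setT r.
  apply: measurable_funD.
    exact/measurable_fun_bool_natr/measurable_fun_ltr.
  apply: measurable_funM => //.
  exact/measurable_fun_bool_natr/measurable_fun_eqr.
have mh : measurable_fun setT h.
  by apply: measurable_funM => //; apply: measurable_funM; apply: measurable_funB.
(* The factors [c - g] and [r - x] never have opposite signs: [r] is [1] where [g < c] and [0] where
   [g > c]. *)
have h0 t : 0 <= h t.
  rewrite /h mulr_ge0// /r; case: (ltgtP (g t y) c) => [gc|gc|->].
  - by rewrite mulr_ge0 ?subr_ge0 ?mulr0 ?addr0// ltW.
  - by rewrite mulr_le0// ?subr_le0 ?mulr0 ?addr0 ltW.
  - by rewrite subrr mul0r.
have qE : q = (\int[muT]_t (g t y * phi t y * r t)%:E)%E.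
  by apply: eq_integral => t _; rewrite rE.
have q0 : (0 <= q)%E.
  by rewrite qE; apply: integral_ge0 => t _; rewrite lee_fin !mulr_ge0.
have mphir : measurable_fun setT (fun t => r t * phi t y) by exact: measurable_funM.
have hq : (\int[muT]_t (h t)%:E + q = x%:E)%E.
  (* Expanding [h] and moving the negative terms to the other side leaves only nonnegative summands,
     so additivity of the integral applies without integrability conditions. The right side
     integrates to [c * x + x], and [c * x] then cancels. *)
  have : (\int[muT]_t ((h t + g t y * phi t y * r t) + c * x * phi t y)%:E =
      \int[muT]_t (c * (r t * phi t y) + x * (g t y * phi t y))%:E)%E.
    by apply: eq_integral => t _; congr EFin; rewrite /h; ring.
  under eq_integral do rewrite EFinD EFinD [X in (_ + X)%E]EFinM.
  under [RHS]eq_integral do rewrite EFinD EFinM [X in (_ + X)%E]EFinM.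
  have mgr : measurable_fun setT (fun t => (g t y * phi t y * r t)%:E).
    exact/measurable_EFinP/measurable_funM.
  rewrite ge0_integralD//; last 4 first.
  + by move=> t _; rewrite adde_ge0// lee_fin// !mulr_ge0.
  + apply: emeasurable_funD => //; exact/measurable_EFinP.
  + by move=> t _; rewrite lee_fin !mulr_ge0// ltW.
  + by apply/measurable_EFinP/measurable_funM.
  rewrite ge0_integralD//; last 3 first.
  + by move=> t _; rewrite lee_fin.
  + exact/measurable_EFinP.
  + by move=> t _; rewrite lee_fin !mulr_ge0.
  rewrite -qE ge0_integralZl//; last 3 first.
  + exact/measurable_EFinP.
  + by move=> t _; rewrite lee_fin.
  + by rewrite lee_fin mulr_ge0// ltW.
  rewrite phi1 mule1 ge0_integralD//; last 4 first.
  + by move=> t _; rewrite lee_fin !mulr_ge0.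
  + by apply/measurable_EFinP/measurable_funM.
  + by move=> t _; rewrite lee_fin !mulr_ge0// ltW.
  + by apply/measurable_EFinP/measurable_funM.
  rewrite ge0_integralZl//; last 2 first.
  + exact/measurable_EFinP.
  + by move=> t _; rewrite lee_fin mulr_ge0.
  rewrite ge0_integralZl//; last 3 first.
  + exact/measurable_EFinP.
  + by move=> t _; rewrite lee_fin mulr_ge0.
  + by rewrite lee_fin ltW.
  rewrite gphi1 mule1 int_r -EFinM [RHS]addeC => /(congr1 (fun z => z - (c * x)%:E)%E).
  by rewrite !addeK.
split; first by rewrite -hq leeDr// integral_ge0// => t _; rewrite lee_fin.
move=> qx.
have h_int0 : (\int[muT]_t `|(h t)%:E| = 0)%E.
  rewrite (_ : integral _ _ _ = \int[muT]_t (h t)%:E)%E; last first.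
    by apply: eq_integral => t _; rewrite gee0_abs// lee_fin.
  by move: hq; rewrite qx => /(congr1 (fun z => z - x%:E)%E); rewrite addeK// subee.
have mhE : measurable_fun setT (EFin \o h) by exact/measurable_EFinP.
have /ae_eq_integral_abs gc := h_int0.
(* Where [h] vanishes and [g] differs from [c], the factor [r - x] would be [1 - x] or [- x]; both
   are nonzero since [0 < x < 1], and [phi] is positive. *)
have {}gc : {ae muT, forall t, g t y = c}.
  apply: filterS (gc measurableT mhE) => t /(_ I) [] /eqP.
  rewrite /h !mulf_eq0 (gt_eqF (phi0 t)) orbF /r.
  case: (ltgtP (g t y) c) => // cg;
    rewrite mulr0 addr0 ?sub0r ?oppr_eq0 !subr_eq0 ?(gt_eqF x0) ?(gt_eqF x1) ?orbF.
    by rewrite (gt_eqF cg).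
  by rewrite (lt_eqF cg).
suff -> : 1 = c by [].
(* Integrating [g * phi = c * phi] compares the two unit masses and gives [c = 1]. *)
apply: EFin_inj; rewrite -gphi1.
transitivity (\int[muT]_t (c%:E * (phi t y)%:E))%E.
  apply: ge0_ae_eq_integral => //.
  + exact/measurable_EFinP.
  + by apply/measurable_EFinP/measurable_funM.
  + by move=> t _; rewrite lee_fin mulr_ge0.
  + by move=> t _; rewrite lee_fin mulr_ge0.
  + by apply: filterS gc => t -> _.
rewrite ge0_integralZl//=; first by rewrite phi1 mule1.
+ exact/measurable_EFinP.
+ by move=> t _; rewrite lee_fin.
Qed.

(** Under [phi] the law of [g] is a point mass at [1], so at the value [1] both [C] and [D] equal
    [1] and the rank is [1 - U]. *)
Lemma r_SBC_ae_const (x : R) (t0 : Theta) : {ae muT, forall t, g t y = 1} ->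
  0 <= x -> x <= 1 -> g t0 y = 1 -> r_SBC muT phi g x t0 y = x%:E.
Proof.
move=> g1 x0 x1 gt0.
have mphiE : measurable_fun setT (fun t => (phi t y)%:E) by exact/measurable_EFinP.
have C1 : C_SBC muT phi g 1 y = 1%E.
  rewrite -phi1; apply: ge0_ae_eq_integral => //.
  - apply/measurable_EFinP/measurable_funM => //.
    exact/measurable_fun_bool_natr/measurable_fun_ler.
  - by move=> t _; rewrite lee_fin mulr_ge0.
  - by move=> t _; rewrite lee_fin.
  - by apply: filterS g1 => t -> _; rewrite lexx mul1r.
have D1 : D_SBC muT phi g 1 y = 1%E.
  rewrite -phi1; apply: ge0_ae_eq_integral => //.
  - apply/measurable_EFinP/measurable_funM => //.
    exact/measurable_fun_bool_natr/measurable_fun_eqr.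
  - by move=> t _; rewrite lee_fin mulr_ge0.
  - by move=> t _; rewrite lee_fin.
  - by apply: filterS g1 => t -> _; rewrite eqxx mul1r.
have [||rho [rE _ _]] := @uniform_le_mid R 1 1 x ler01; rewrite ?subrr//.
rewrite mulr1 subrK => rhoE.
by rewrite /r_SBC gt0 C1 D1 rE rhoE.
Qed.

Lemma q_SBC_ae_const (x : R) : {ae muT, forall t, g t y = 1} -> 0 <= x -> x <= 1 ->
  measurable_fun setT (r_SBC muT phi g x ^~ y) ->
  (\int[muT]_t ((g t y * phi t y)%:E * r_SBC muT phi g x t y) = x%:E)%E.
Proof.
move=> g1 x0 x1 mr.
have mphiE : measurable_fun setT (fun t => (phi t y)%:E) by exact/measurable_EFinP.
transitivity (\int[muT]_t (x%:E * (phi t y)%:E))%E; last first.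
  rewrite ge0_integralZl//; first by rewrite phi1 mule1.
  by move=> t _; rewrite lee_fin.
apply: ge0_ae_eq_integral => //.
- apply: emeasurable_funM => //; apply/measurable_EFinP.
  exact: measurable_funM.
- exact: emeasurable_funM.
- by move=> t _; rewrite mule_ge0// lee_fin mulr_ge0.
- by move=> t _; rewrite lee_fin mulr_ge0.
- apply: filterS (g1) => t gt _.
  by rewrite (r_SBC_ae_const g1)// gt mul1r muleC.
Qed.

End one_observation.

(** Under the alternative [p <= w] almost everywhere, and equal masses leave no room for a strict
    inequality. This handles the points of zero joint density, about which the vanishing double
    integral says nothing. *)
Lemma ae_eq_of_ae_eq0_or {R : realType} {d : measure_display} {T : measurableType d}
  (mu : {measure set T -> \bar R}) (p w : T -> R) :
  measurable_fun setT p -> measurable_fun setT w ->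
  (forall t, 0 <= p t) -> (forall t, 0 <= w t) ->
  (\int[mu]_t (p t)%:E = 1)%E -> (\int[mu]_t (w t)%:E = 1)%E ->
  {ae mu, forall t, p t = 0 \/ p t = w t} -> {ae mu, forall t, p t = w t}.
Proof.
move=> mp mw p0 w0 p1 w1 pw.
pose k t := (w t - p t)%:E.
have mk : measurable_fun setT k by exact/measurable_EFinP/measurable_funB.
(* Almost everywhere [|w - p| + p = w], in both cases of the alternative; subtracting the common
   mass [1] shows that [|w - p|] has integral [0]. *)
have : (\int[mu]_t (`|k t| + (p t)%:E) = \int[mu]_t (w t)%:E)%E.
  apply: ge0_ae_eq_integral => //.
  - apply: emeasurable_funD; first exact: measurableT_comp.
    exact/measurable_EFinP.
  - exact/measurable_EFinP.
  - by move=> t _; rewrite adde_ge0// lee_fin.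
  - by move=> t _; rewrite lee_fin.
  - apply: filterS pw => t + _ => -[|] pt; rewrite /k pt.
      by rewrite subr0 adde0 gee0_abs// lee_fin.
    by rewrite subrr abse0 add0e.
rewrite ge0_integralD//; last 3 first.
- exact: measurableT_comp.
- by move=> t _; rewrite lee_fin.
- exact/measurable_EFinP.
rewrite p1 w1 => /(congr1 (fun z => z - 1)%E); rewrite addeK// subee// => k0.
apply: filterS (iffLR (ae_eq_integral_abs mu measurableT mk) k0) => t /(_ I) [] /eqP.
by rewrite subr_eq0 => /eqP ->.
Qed.

(** * Joint measurability of the rank functions in parameter and observation *)

Section joint_measurability.
Set Implicit Arguments. Unset Strict Implicit.
Context {R : realType} {d1 d2 : measure_display}
  {Theta : measurableType d1} {Y : measurableType d2}.
Variables (muT : {sigma_finite_measure set Theta -> \bar R}).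
Variables (phi f : Theta -> Y -> R).
Hypotheses (mphi : measurable_fun setT (fun p : Theta * Y => phi p.1 p.2))
  (phi0 : forall t y, 0 <= phi t y)
  (mf : measurable_fun setT (fun p : Theta * Y => f p.1 p.2)).

(** A triple holds the reference parameter, the observation and, last, the integration variable of
    [C_SBC] and [D_SBC]. The map keeps the integration variable and the observation. *)
Let sel : (Theta * Y) * Theta -> Theta * Y := fun z => (z.2, z.1.2).

Let msel : measurable_fun setT sel.
Proof.
apply: measurable_fun_pair => //.
exact: measurableT_comp measurable_snd measurable_fst.
Qed.

Let mf_test : measurable_fun setT (fun z : (Theta * Y) * Theta => f z.2 z.1.2).
Proof. exact: (measurableT_comp mf msel). Qed.

Let mf_obs : measurable_fun setT (fun z : (Theta * Y) * Theta => f z.1.1 z.1.2).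
Proof. exact: (measurableT_comp mf measurable_fst). Qed.

Let mphi_sel : measurable_fun setT (fun z : (Theta * Y) * Theta => phi z.2 z.1.2).
Proof. exact: (measurableT_comp mphi msel). Qed.

Lemma measurable_C_SBC :
  measurable_fun setT (fun p : Theta * Y => C_SBC muT phi f (f p.1 p.2) p.2).
Proof.
apply: (measurable_fun_fubini_tonelli_F (m2 := muT)
  (fun z : (Theta * Y) * Theta =>
    ((f z.2 z.1.2 <= f z.1.1 z.1.2)%R%:R * phi z.2 z.1.2)%:E)).
  apply/measurable_EFinP/measurable_funM => //.
  exact/measurable_fun_bool_natr/measurable_fun_ler.
by move=> z; rewrite lee_fin mulr_ge0.
Qed.

Lemma measurable_D_SBC :
  measurable_fun setT (fun p : Theta * Y => D_SBC muT phi f (f p.1 p.2) p.2).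
Proof.
apply: (measurable_fun_fubini_tonelli_F (m2 := muT)
  (fun z : (Theta * Y) * Theta =>
    ((f z.2 z.1.2 == f z.1.1 z.1.2)%R%:R * phi z.2 z.1.2)%:E)).
  apply/measurable_EFinP/measurable_funM => //.
  exact/measurable_fun_bool_natr/measurable_fun_eqr.
by move=> z; rewrite lee_fin mulr_ge0.
Qed.

(** For each pair the probability is the Lebesgue measure of a section of one measurable set [A] in
    the product with the line, hence measurable in the pair. *)
Lemma measurable_r_SBC (x : R) :
  measurable_fun setT (fun p : Theta * Y => r_SBC muT phi f x p.1 p.2).
Proof.
pose A := [set z : (Theta * Y) * R | z.2 \in `[0, 1] /\
  (C_SBC muT phi f (f z.1.1 z.1.2) z.1.2 -
   z.2%:E * D_SBC muT phi f (f z.1.1 z.1.2) z.1.2 <= x%:E)%E].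
have mA : measurable A.
  apply: measurableI.
    have := @measurable_snd _ _ (Theta * Y)%type R measurableT _
      (measurable_itv (`[0, 1] : interval R)).
    by rewrite setTI.
  rewrite -[X in measurable X]setTI; apply: measurable_lee => //.
  apply: emeasurable_funB.
    exact: (measurableT_comp measurable_C_SBC measurable_fst).
  apply: emeasurable_funM.
    exact/measurable_EFinP.
  exact: (measurableT_comp measurable_D_SBC measurable_fst).
have := measurable_fun_xsection (@lebesgue_measure R) mA.
apply: eq_measurable_fun => p _.
rewrite /r_SBC /=; congr (_ _); apply/seteqP; split => u.
  by rewrite /xsection/= inE.
by rewrite /xsection/= inE.
Qed.

End joint_measurability.

(** On nonnegative reals inversion is the power function of exponent [-1]; at [0] both take the
    value [0]. *)
Lemma ge0_measurable_funV {R : realType} {d : measure_display} {T : measurableType d}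
  (f : T -> R) : (forall t, 0 <= f t) -> measurable_fun setT f ->
  measurable_fun setT (fun t => (f t)^-1).
Proof.
move=> f0 mf; have -> : (fun t => (f t)^-1) = (fun a : R => powR a (-1)) \o f.
  by apply/funext => t /=; rewrite powR_inv1.
by apply: measurableT_comp; first exact: measurable_powR.
Qed.

(** * The marginal and posterior densities of the model *)

Section posterior.
Set Implicit Arguments. Unset Strict Implicit.
Context {R : realType} {d1 d2 : measure_display}
  {Theta : measurableType d1} {Y : measurableType d2}.
Variables (muT : {sigma_finite_measure set Theta -> \bar R})
  (muY : {sigma_finite_measure set Y -> \bar R})
  (prior : Theta -> R) (obs : Theta -> Y -> R).
Hypotheses (mprior : measurable_fun setT prior) (prior0 : forall t, 0 <= prior t)
  (prior1 : (\int[muT]_t (prior t)%:E = 1)%E)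
  (mobs : measurable_fun setT (fun p : Theta * Y => obs p.1 p.2))
  (obs0 : forall t y, 0 <= obs t y)
  (obs1 : forall t, (\int[muY]_y (obs t y)%:E = 1)%E).

Lemma pi_joint_ge0 y t : 0 <= pi_joint prior obs y t.
Proof. exact: mulr_ge0. Qed.

Lemma measurable_pi_joint :
  measurable_fun setT (fun p : Theta * Y => pi_joint prior obs p.2 p.1).
Proof.
apply: measurable_funM => //.
exact: (measurableT_comp mprior measurable_fst).
Qed.

Lemma pi_marg_ge0 y : (0 <= pi_marg muT prior obs y)%E.
Proof. by apply: integral_ge0 => t _; rewrite lee_fin pi_joint_ge0. Qed.

Lemma measurable_pi_marg : measurable_fun setT (pi_marg muT prior obs).
Proof.
apply: (measurable_fun_fubini_tonelli_G (m1 := muT)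
  (fun p : Theta * Y => (pi_joint prior obs p.2 p.1)%:E)).
  by apply/measurable_EFinP; exact: measurable_pi_joint.
by move=> p; rewrite lee_fin pi_joint_ge0.
Qed.

(** Tonelli exchanges the integrals; for each parameter the observation density integrates to [1],
    which leaves the prior mass. *)
Lemma integral_pi_marg : (\int[muY]_y pi_marg muT prior obs y = 1)%E.
Proof.
rewrite /pi_marg -(fubini_tonelli
  (fun p : Theta * Y => (pi_joint prior obs p.2 p.1)%:E)); last 2 first.
- by apply/measurable_EFinP; exact: measurable_pi_joint.
- by move=> p; rewrite lee_fin pi_joint_ge0.
rewrite -prior1; apply: eq_integral => t _ /=.
under eq_integral do rewrite /pi_joint mulrC EFinM.
rewrite ge0_integralZl//=; first by rewrite obs1 mule1.
- by apply/measurable_EFinP; exact: (measurableT_comp mobs (measurable_pair1 t)).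
- by move=> y _; rewrite lee_fin.
- by rewrite lee_fin.
Qed.

Lemma pi_marg_ae_fin_num : {ae muY, forall y, pi_marg muT prior obs y \is a fin_num}.
Proof.
have : muY.-integrable setT (pi_marg muT prior obs).
  apply/integrableP; split; first exact: measurable_pi_marg.
  under eq_integral do rewrite gee0_abs ?pi_marg_ge0//.
  by rewrite integral_pi_marg ltry.
move=> /(integrable_ae measurableT); apply: filterS => y; exact.
Qed.

Lemma integral_fine_pi_marg :
  (\int[muY]_y (fine (pi_marg muT prior obs y))%:E = 1)%E.
Proof.
rewrite -integral_pi_marg; apply: ge0_ae_eq_integral => //.
- by apply/measurable_EFinP; apply: measurableT_comp => //; exact: measurable_pi_marg.
- exact: measurable_pi_marg.
- by move=> y _; rewrite lee_fin fine_ge0 ?pi_marg_ge0.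
- by move=> y _; exact: pi_marg_ge0.
- by apply: filterS pi_marg_ae_fin_num => y my _; rewrite fineK.
Qed.

Lemma pi_post_ge0 t y : 0 <= pi_post muT prior obs t y.
Proof. by rewrite divr_ge0 ?pi_joint_ge0 ?fine_ge0 ?pi_marg_ge0. Qed.

Lemma measurable_pi_post :
  measurable_fun setT (fun p : Theta * Y => pi_post muT prior obs p.1 p.2).
Proof.
apply: measurable_funM; first exact: measurable_pi_joint.
apply: ge0_measurable_funV; first by move=> p; rewrite fine_ge0// pi_marg_ge0.
apply: measurableT_comp => //.
exact: (measurableT_comp measurable_pi_marg measurable_snd).
Qed.

(** Since [fine] sends infinity to [0], the condition excludes both a vanishing and an infinite
    marginal. *)
Lemma integral_pi_post y : fine (pi_marg muT prior obs y) != 0 ->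
  (\int[muT]_t (pi_post muT prior obs t y)%:E = 1)%E.
Proof.
move=> m0; rewrite /pi_post.
under eq_integral do rewrite mulrC EFinM.
rewrite ge0_integralZl//=.
- rewrite -/(pi_marg muT prior obs y).
  have {2}<- : (fine (pi_marg muT prior obs y))%:E = pi_marg muT prior obs y.
    by rewrite fineK//; move: m0; case: (pi_marg _ _ _ _) => //=; rewrite eqxx.
  by rewrite -EFinM mulVf.
- by apply/measurable_EFinP; exact: (measurableT_comp measurable_pi_joint (measurable_pair2 y)).
- by move=> t _; rewrite lee_fin pi_joint_ge0.
- by rewrite lee_fin invr_ge0 fine_ge0// pi_marg_ge0.
Qed.

End posterior.

(** * The equivalence, by averaging the fixed-observation results over the data *)

Theorem theorem6 (R : realType) (d1 d2 : measure_display)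
  (Theta : measurableType d1) (Y : measurableType d2)
  (muT : {sigma_finite_measure set Theta -> \bar R})
  (muY : {sigma_finite_measure set Y -> \bar R})
  (prior : Theta -> R) (obs : Theta -> Y -> R) (phi : Theta -> Y -> R) :
  (* model: prior density *)
  measurable_fun setT prior ->
  (forall t, 0 <= prior t) ->
  (\int[muT]_t (prior t)%:E = 1)%E ->
  (* model: observation density *)
  measurable_fun setT (fun p : Theta * Y => obs p.1 p.2) ->
  (forall t y, 0 <= obs t y) ->
  (forall t, \int[muY]_y (obs t y)%:E = 1)%E ->
  (* posterior family (values in R^+) *)
  measurable_fun setT (fun p : Theta * Y => phi p.1 p.2) ->
  (forall t y, 0 < phi t y) ->
  (forall y, \int[muT]_t (phi t y)%:E = 1)%E ->
  let g := fun t y => pi_post muT prior obs t y / phi t y in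
  passes_SBC muT muY prior obs phi g <->
  (\int[muY]_y \int[muT]_t
     ((pi_joint prior obs y t) * (pi_post muT prior obs t y != phi t y)%:R)%:E = 0)%E.
Proof.
move=> mprior prior0 prior1 mobs obs0 obs1 mphi phi0 phi1 g.
pose marg := pi_marg muT prior obs; pose m y := fine (marg y).
pose post := pi_post muT prior obs.
have marg0 y : (0 <= marg y)%E by exact: pi_marg_ge0.
have m0 y : 0 <= m y by exact: fine_ge0.
have mmarg : measurable_fun setT marg by exact: measurable_pi_marg.
have mm : measurable_fun setT (fun y => (m y)%:E).
  by apply/measurable_EFinP; exact: measurableT_comp.
have m1 : (\int[muY]_y (m y)%:E = 1)%E by exact: integral_fine_pi_marg.
have phi_ge0 t y : 0 <= phi t y by exact: ltW.
have post0 t y : 0 <= post t y by exact: pi_post_ge0.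
have mpost : measurable_fun setT (fun p : Theta * Y => post p.1 p.2).
  exact: measurable_pi_post.
have mjoint : measurable_fun setT (fun p : Theta * Y => pi_joint prior obs p.2 p.1).
  exact: measurable_pi_joint.
have g0 t y : 0 <= g t y by rewrite divr_ge0.
have gphi t y : g t y * phi t y = post t y by rewrite divfK// gt_eqF.
have g1 t y : (g t y = 1) <-> (post t y = phi t y).
  by split=> [gt|pt]; [rewrite -gphi gt mul1r|rewrite /g -/(post _ _) pt divff// gt_eqF].
have mg : measurable_fun setT (fun p : Theta * Y => g p.1 p.2).
  apply: measurable_funM => //; exact: ge0_measurable_funV.
have mphiy y : measurable_fun setT (phi ^~ y).
  exact: (measurableT_comp mphi (measurable_pair2 y)).
have mgy y : measurable_fun setT (g ^~ y).
  exact: (measurableT_comp mg (measurable_pair2 y)).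
have mposty y : measurable_fun setT (post ^~ y).
  exact: (measurableT_comp mpost (measurable_pair2 y)).
have mr x := measurable_r_SBC muT mphi phi_ge0 mg x.
pose q x y := q_SBC muT prior obs phi g x y.
have r0 x t y : (0 <= r_SBC muT phi g x t y)%E by exact: measure_ge0.
have q0 x y : (0 <= q x y)%E.
  by apply: integral_ge0 => t _; rewrite mule_ge0// lee_fin.
have mq x : measurable_fun setT (q x).
  apply: (measurable_fun_fubini_tonelli_G (m1 := muT) (fun p : Theta * Y =>
    ((post p.1 p.2)%:E * r_SBC muT phi g x p.1 p.2)%E)).
    by apply: emeasurable_funM => //; exact/measurable_EFinP.
  by move=> p; rewrite mule_ge0// lee_fin.
have qE x y : q x y =
    (\int[muT]_t ((g t y * phi t y)%:E * r_SBC muT phi g x t y))%E.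
  by apply: eq_integral => t _; rewrite gphi.
have gphi1 y : m y != 0 -> (\int[muT]_t (g t y * phi t y)%:E = 1)%E.
  by move=> my; under eq_integral do rewrite gphi; exact: integral_pi_post.
(* Division by zero yields [0], so the posterior is identically [0] at such an observation. *)
have q_m0 x y : m y = 0 -> q x y = 0%E.
  move=> my; rewrite /q /q_SBC integral0_eq// => t _.
  by rewrite /pi_post -/marg -/(m y) my invr0 mulr0 mul0e.
(* The marginal may be infinite at some observations; there [m y] and [q x y] are [0], and zero
   times infinity is [0]. *)
have qmE x y : (q x y * marg y = q x y * (m y)%:E)%E.
  have [|my] := boolP (marg y \is a fin_num); first by move=> ?; rewrite fineK.
  rewrite q_m0 ?mul0e// /m; move: my (marg0 y).
  by case: (marg y).
pose inner y := (\int[muT]_t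
  (pi_joint prior obs y t * (post t y != phi t y)%:R)%:E)%E.
have mintegrand : measurable_fun setT (fun p : Theta * Y =>
    pi_joint prior obs p.2 p.1 * (post p.1 p.2 != phi p.1 p.2)%:R).
  apply: measurable_funM => //; apply: measurable_fun_bool_natr.
  by apply: measurable_neg; exact: measurable_fun_eqr.
have integrand0 t y : 0 <= pi_joint prior obs y t * (post t y != phi t y)%:R.
  by rewrite mulr_ge0// pi_joint_ge0.
have inner0 y : (0 <= inner y)%E.
  by apply: integral_ge0 => t _; rewrite lee_fin.
have minner : measurable_fun setT inner.
  apply: (measurable_fun_fubini_tonelli_G (m1 := muT) (fun p : Theta * Y =>
    (pi_joint prior obs p.2 p.1 * (post p.1 p.2 != phi p.1 p.2)%:R)%:E)).
    exact/measurable_EFinP.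
  by move=> p; rewrite lee_fin.
have mintegrandy y : measurable_fun setT (fun t =>
    (pi_joint prior obs y t * (post t y != phi t y)%:R)%:E).
  by apply/measurable_EFinP; exact: (measurableT_comp mintegrand (measurable_pair2 y)).
have marg_fin : {ae muY, forall y, marg y \is a fin_num} by exact: pi_marg_ae_fin_num.
split=> [pass|null].
- have x0 : 0 < 2^-1 :> R by rewrite invr_gt0.
  have x1 : 2^-1 < 1 :> R by rewrite invf_lt1// ltr1n.
  set x : R := 2^-1 in x0 x1.
  have qgap y : m y != 0 -> (q x y <= x%:E)%E /\
      (q x y = x%:E -> {ae muT, forall t, g t y = 1}).
    move=> my; rewrite qE.
    exact: q_SBC_gap (mphiy y) (phi0 ^~ y) (mgy y) (phi1 y) (g0 ^~ y) (gphi1 _ my) _ x0 x1.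
  have qx y : (q x y <= x%:E)%E.
    have [my|my] := eqVneq (m y) 0; last by case: (qgap y my).
    by rewrite q_m0// lee_fin ltW.
  have qfin y : q x y \is a fin_num.
    by rewrite ge0_fin_numE// (le_lt_trans (qx y))// ltry.
  pose k y := ((x%:E - q x y) * (m y)%:E)%E.
  have k0 y : (0 <= k y)%E.
    apply: mule_ge0; last by rewrite lee_fin.
    by rewrite suber_ge0.
  have mk : measurable_fun setT k.
    by apply: emeasurable_funM => //; apply: emeasurable_funB.
  (* Pointwise the integrand is [x * m y], and [m] has mass [1]. As SBC makes the second summand
     integrate to [x] alone, the weighted gap [k] has integral [0]. *)
  have : (\int[muY]_y (k y + q x y * marg y) = x%:E)%E.
    transitivity (\int[muY]_y (x%:E * (m y)%:E))%E; last first.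
      rewrite ge0_integralZl//; first by rewrite m1 mule1.
      - by move=> y _; rewrite lee_fin.
      - by rewrite lee_fin ltW.
    apply: eq_integral => y _.
    by rewrite qmE /k -muleDl// ?subeK// fin_num_adde_defl.
  rewrite ge0_integralD//; last 2 first.
  + by move=> y _; rewrite mule_ge0.
  + exact: emeasurable_funM.
  rewrite (pass x) ?ltW//= => /(congr1 (fun z => z - x%:E)%E).
  rewrite addeK// subee// => intk.
  have absk : (\int[muY]_y `|k y| = 0)%E.
    by rewrite -[RHS]intk; apply: eq_integral => y _; rewrite gee0_abs.
  have ktae := iffLR (ae_eq_integral_abs muY measurableT mk) absk.
  have inner_ae : {ae muY, forall y, inner y = 0%E}.
    apply: filterS2 marg_fin ktae => y my_fin /(_ I) ky.
    (* A finite marginal with [m y = 0] is zero, and it bounds [inner y] because the indicator is at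
       most [1]. *)
    have [my|my] := eqVneq (m y) 0.
      apply/eqP; rewrite eq_le inner0 andbT.
      have <- : marg y = 0%E by rewrite -(fineK my_fin) -/(m y) my.
      apply: ge0_le_integral => //.
      - by move=> t _; rewrite lee_fin.
      - apply/measurable_EFinP.
        exact: (measurableT_comp mjoint (measurable_pair2 y)).
      - move=> t _; rewrite lee_fin ler_piMr ?pi_joint_ge0//.
        by case: (_ != _).
    have {}ky : q x y = x%:E.
      move: ky => /eqP; rewrite /k mule_eq0 eqe (negbTE my) orbF => /eqP.
      by move=> /(congr1 (fun z => z + q x y)%E); rewrite subeK// add0e.
    have [_ /(_ ky) gae] := qgap y my.
    rewrite -(integral0 muT setT); apply: ge0_ae_eq_integral => //.
    - by move=> t _; rewrite lee_fin.
    - by apply: filterS gae => t /g1 -> _; rewrite eqxx mulr0.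
  rewrite -(integral0 muY setT); apply: ge0_ae_eq_integral => //.
  - by move=> y _; exact: inner0.
  - by apply: filterS inner_ae => y iy _.
- move=> x /andP[x0 x1].
  have absin : (\int[muY]_y `|inner y| = 0)%E.
    by rewrite -[RHS]null; apply: eq_integral => y _; rewrite gee0_abs.
  have innerae := iffLR (ae_eq_integral_abs muY measurableT minner) absin.
  transitivity (\int[muY]_y (x%:E * (m y)%:E))%E; last first.
    rewrite ge0_integralZl//; first by rewrite m1 mule1.
    by move=> y _; rewrite lee_fin.
  apply: ge0_ae_eq_integral => //.
  + exact: emeasurable_funM.
  + exact: emeasurable_funM.
  + by move=> y _; rewrite mule_ge0.
  + by move=> y _; rewrite mule_ge0// lee_fin.
  apply: filterS innerae => y /(_ I) innery _; rewrite qmE.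
  have [my|my] := eqVneq (m y) 0; first by rewrite my !mule0.
  congr (_ * _)%E; rewrite qE; apply: q_SBC_ae_const => //; last first.
    exact: (measurableT_comp (mr x) (measurable_pair2 y)).
  have absy : (\int[muT]_t
      `|(pi_joint prior obs y t * (post t y != phi t y)%:R)%:E| = 0)%E.
    by rewrite -[RHS]innery; apply: eq_integral => t _; rewrite gee0_abs// lee_fin.
  have := iffLR (ae_eq_integral_abs muT measurableT (mintegrandy y)) absy.
  move=> tae.
  (* The vanishing integral gives, almost everywhere, either equality of the two densities or a zero
     joint density, in which case the posterior is [0] too. Both densities have mass [1], so the
     second case can hold only on a null set. *)
  have : {ae muT, forall t, post t y = phi t y}.
    apply: ae_eq_of_ae_eq0_or => //; first exact: integral_pi_post.
    apply: filterS tae => t /(_ I) [] /eqP; rewrite mulf_eq0 => /orP[/eqP j0|].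
      by left; rewrite /post /pi_post j0 mul0r.
    by rewrite pnatr_eq0 eqb0 negbK => /eqP; right.
  by apply: filterS => t /g1.
Qed.
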